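(* Let $\mathbb{F}$ be any field, let $d$ and $m$ be integers with $1\le m\le d-1$. Let $(\mathcal J,\mathcal L,\mathcal F)$ be a $(1^m,d-m)$-joints configuration in $\mathbb{F}^d$. Then \[ |\mathcal J|\le \binom{d}{m}^{1/m}\,|\mathcal L|\,|\mathcal F|^{1/m}. \]
   Context: A $(1^m,d-m)$-joints configuration $(\mathcal J,\mathcal L,\mathcal F)$ in $\mathbb{F}^d$ consists of a finite set $\mathcal L$ of lines in $\mathbb{F}^d$, a finite set $\mathcal F$ of $(d-m)$-dimensional affine subspaces ($(d-m)$-flats) of $\mathbb{F}^d$, and a set $\mathcal J$ of joints, each joint being a point that is the intersection of $m$ lines from $\mathcal L$ and one flat from $\mathcal F$, these $m$ lines and the flat not all lying in some hyperplane (equivalently, the directions of the $m$ lines together with the direction space of the flat span $\mathbb{F}^d$). *)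

(* Defs.v *)
From mathcomp Require Import all_boot all_order all_algebra finmap.
From mathcomp Require Import boolp classical_sets cardinality reals exp.

Set Implicit Arguments.
Unset Strict Implicit.
Unset Printing Implicit Defensive.
Import GRing.Theory.

Local Open Scope classical_set_scope.
Local Open Scope ring_scope.

Definition is_flat (F : fieldType) (d k : nat) (A : set 'rV[F]_d) : Prop :=
  exists (p : 'rV[F]_d) (V : {vspace 'rV[F]_d}),
    \dim V = k /\ A = [set x | x - p \in V].

Definition is_line (F : fieldType) (d : nat) (A : set 'rV[F]_d) : Prop :=
  is_flat 1 A.

Definition is_hyperplane (F : fieldType) (d : nat) (A : set 'rV[F]_d) : Prop :=
  is_flat (d - 1) A.

Definition is_joint (F : fieldType) (d m : nat)
    (Ls Fs : {fset set 'rV[F]_d}) (x : 'rV[F]_d) : Prop :=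
  exists (l : 'I_m -> set 'rV[F]_d) (f : set 'rV[F]_d),
    [/\ injective l /\ (forall i, l i \in Ls),
        f \in Fs,
        (\bigcap_i l i) `&` f = [set x] &
        ~ exists H : set 'rV[F]_d,
            [/\ is_hyperplane H, forall i, l i `<=` H & f `<=` H]].

(* [Js] may be any set of joints: it need not contain all of them, and its
   finiteness is not part of the data. *)
Definition joints_configuration (F : fieldType) (d m : nat)
    (Js : set 'rV[F]_d) (Ls Fs : {fset set 'rV[F]_d}) : Prop :=
  [/\ forall l, l \in Ls -> is_line l,
      forall f, f \in Fs -> is_flat (d - m) f &
      forall x, Js x -> is_joint m Ls Fs x].

(* Main.v *)
(** The proof is by the polynomial method with multiplicities.  Let [g] be a
nonzero polynomial of degree at most [n].  At a joint [q], take as basis the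
directions of its [m] lines and a basis of its flat, and let [e_q] be the
exponent of a monomial of least degree in the expansion of [g] at [q].  Restrict
to a line [l] the coefficients of the expansion at the joint [p] of [l] which
minimizes the degree of [e_p] outside [l]: this is a nonzero univariate
polynomial of degree at most [n] which vanishes at each joint [q] of [l] to order
at least the [l]-component of [e_q].  Hence these components sum to at most [n]
along each line, and to at most [n |L|] over all lines.  If [g] vanishes to order
[r] along each flat, then the line components of [e_q] sum to at least [r] at
each joint, so that [r |J| <= n |L|].  Such a [g] exists as soon as
[|F| C(m+r-1,m) C(k+n,k) < C(d+n,d)], where [k = d - m]; if the theorem failed,
this would hold for [r = |L| t] and [n = |J| t - 1] with [t] large, and then
[r |J| > n |L|]. *)
Require Import Defs.
From HB Require Import structures.
From mathcomp Require Import all_boot all_order all_algebra finmap.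
From mathcomp Require Import boolp classical_sets cardinality reals exp.
From mathcomp Require Import mpoly zify.

Set Implicit Arguments.
Unset Strict Implicit.
Unset Printing Implicit Defensive.
Import Order.TTheory GRing.Theory Num.Theory.

Local Open Scope classical_set_scope.
Local Open Scope ring_scope.

(** * Weights of monomials under substitution *)

Section Substitution.
Variable F : fieldType.

Definition weight d (w : 'I_d -> nat) (e : 'X_{1..d}) : nat :=
  (\sum_i w i * e i)%N.

Lemma weightD d (w : 'I_d -> nat) (a b : 'X_{1..d}) :
  weight w (a + b)%MM = (weight w a + weight w b)%N.
Proof.
by rewrite -big_split; apply: eq_bigr => i _; rewrite mnmDE mulnDr.
Qed.

Lemma weight0 d (w : 'I_d -> nat) : weight w 0%MM = 0%N.
Proof. by apply: big1 => i _; rewrite mnm0E muln0. Qed.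

Lemma weightU d (w : 'I_d -> nat) i : weight w U_(i)%MM = w i.
Proof.
rewrite /weight (bigD1 i) //= mnm1E eqxx muln1 big1 ?addn0 // => j.
by rewrite mnm1E eq_sym => /negPf ->; rewrite muln0.
Qed.

Lemma weight1 d (e : 'X_{1..d}) : weight (fun=> 1%N) e = mdeg e.
Proof. by rewrite mdegE; apply: eq_bigr => i _; rewrite mul1n. Qed.

(* [le] is instantiated by [leq] for orders of vanishing and by [geq] for
   degrees. *)
Definition graded (le : rel nat) d (w : 'I_d -> nat) r (g : {mpoly F[d]}) :=
  forall e, e \in msupp g -> le r (weight w e).

Section Graded.
Variable le : rel nat.
Hypothesis le0 : le 0%N 0%N.
Hypothesis leD : forall a b c d, le a c -> le b d -> le (a + b)%N (c + d)%N.
Hypothesis le_tr : transitive le.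

Variables (d : nat) (w : 'I_d -> nat).
Implicit Types g h : {mpoly F[d]}.

Lemma graded1 : graded le w 0 1.
Proof. by move=> e; rewrite msupp1 inE => /eqP ->; rewrite weight0. Qed.

Lemma gradedM r s g h :
  graded le w r g -> graded le w s h -> graded le w (r + s) (g * h).
Proof.
move=> gr hs e /msuppM_le /allpairsP [[a b] /= [ag bh ->]].
by rewrite weightD; apply: leD; [apply: gr | apply: hs].
Qed.

Lemma gradedX r g k : graded le w r g -> graded le w (r * k) (g ^+ k).
Proof.
move=> gr; elim: k => [|k IH]; first by rewrite muln0; apply: graded1.
by rewrite exprS mulnS; apply: gradedM.
Qed.

Lemma graded_prod (I : Type) (s : seq I) (r : I -> nat) (g : I -> {mpoly F[d]}) :
  (forall i, graded le w (r i) (g i)) ->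
  graded le w (\sum_(i <- s) r i)%N (\prod_(i <- s) g i).
Proof.
move=> gr; elim: s => [|i s IH]; first by rewrite !big_nil; apply: graded1.
by rewrite !big_cons; apply: gradedM.
Qed.

(** A monomial [a] of [g] turns into the product of the [tnth t i ^+ a i], whose monomials have
    weight compared with [weight v a], and transitivity concludes. *)
Lemma graded_comp n (v : 'I_n -> nat) r (g : {mpoly F[n]})
    (t : n.-tuple {mpoly F[d]}) :
  (forall i, graded le w (v i) (tnth t i)) ->
  graded le v r g -> graded le w r (g \mPo t).
Proof.
move=> gt gr; rewrite comp_mpolyE => e /msupp_sum_le /flattenP [s].
case/mapP=> a; rewrite mem_filter /= => ag -> /msuppZ_le ea.
apply: le_tr (gr _ ag) _; move: e ea; apply: graded_prod => i.
exact: gradedX.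
Qed.

End Graded.

Lemma graded_leq_comp d n (w : 'I_d -> nat) (v : 'I_n -> nat) r
    (g : {mpoly F[n]}) (t : n.-tuple {mpoly F[d]}) :
  (forall i, graded leq w (v i) (tnth t i)) ->
  graded leq v r g -> graded leq w r (g \mPo t).
Proof.
apply: graded_comp => //; last exact: leq_trans.
by move=> *; apply: leq_add.
Qed.

Lemma graded_geq_comp d n (w : 'I_d -> nat) (v : 'I_n -> nat) r
    (g : {mpoly F[n]}) (t : n.-tuple {mpoly F[d]}) :
  (forall i, graded geq w (v i) (tnth t i)) ->
  graded geq v r g -> graded geq w r (g \mPo t).
Proof.
apply: graded_comp => //; last by move=> y x z xy yz; apply: leq_trans yz xy.
by move=> *; apply: leq_add.
Qed.

End Substitution.

(** * Affine changes of coordinates *)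

Section Affine.
Variables (F : fieldType) (d : nat).
Implicit Types (p q : 'rV[F]_d) (M N : 'M[F]_d) (g : {mpoly F[d]}).

Definition affine p M : d.-tuple {mpoly F[d]} :=
  [tuple (p 0 i)%:MP + \sum_j M j i *: 'X_j | i < d].

(* The polynomial [x |-> g (p + x M)]: the coordinates of the point are taken
   along the rows of [M]. *)
Definition expand p M g : {mpoly F[d]} := g \mPo affine p M.

Lemma comp_affine p M q N i :
  tnth (affine p M) i \mPo affine q N = tnth (affine (p + q *m M) (N *m M)) i.
Proof.
rewrite !tnth_mktuple raddfD /= comp_mpolyC !mxE mpolyCD -addrA; congr (_ + _).
rewrite raddf_sum /=.
under eq_bigr do rewrite comp_mpolyZ comp_mpolyXU -tnth_nth tnth_mktuple scalerDr.
rewrite big_split /= raddf_sum /=; congr (_ + _).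
  by apply: eq_bigr => j _; rewrite -mul_mpolyC -mpolyCM mulrC.
under eq_bigr do rewrite scaler_sumr.
rewrite exchange_big; apply: eq_bigr => j _ /=.
rewrite mxE scaler_suml; apply: eq_bigr => l _.
by rewrite scalerA mulrC.
Qed.

(** Affine maps compose: [p + (q + x N) M = (p + q M) + x (N M)]. *)
Lemma expandK p M q N g :
  expand q N (expand p M g) = expand (p + q *m M) (N *m M) g.
Proof.
rewrite /expand [g \mPo affine p M]comp_mpolyE raddf_sum comp_mpolyE /=.
apply: eq_bigr => e _; rewrite comp_mpolyZ rmorph_prod /=; congr (_ *: _).
by apply: eq_bigr => i _; rewrite rmorphXn /= comp_affine.
Qed.

Lemma expand1 g : expand 0 1%:M g = g.
Proof.
rewrite /expand -[RHS]comp_mpoly_id; congr (g \mPo _).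
apply: eq_from_tnth => i; rewrite !tnth_mktuple mxE add0r (bigD1 i) //=.
rewrite mxE eqxx scale1r big1 ?addr0 // => j ji.
by rewrite mxE (negPf ji) scale0r.
Qed.

Lemma expand_neq0 p M g : M \in unitmx -> g != 0 -> expand p M g != 0.
Proof.
move=> Mu; apply: contraNneq => e0.
rewrite -(expand1 g) -(mulVmx Mu) -(subrr p).
(* The inverse change of coordinates recovers [g] from its expansion, so a zero expansion would make
   [g] zero. *)
have -> : p - p = p + (- p *m invmx M) *m M by rewrite mulmxKV.
by rewrite -expandK e0 /expand comp_mpoly0.
Qed.

Lemma graded_geq_affine p M i : graded geq (fun=> 1%N) 1 (tnth (affine p M) i).
Proof.
move=> e; rewrite tnth_mktuple => /msuppD_le; rewrite mem_cat => /orP [].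
  by rewrite msuppC; case: ifP => // _; rewrite inE => /eqP ->; rewrite weight0.
move=> /msupp_sum_le /flattenP [s] /mapP [j _ ->] /msuppZ_le.
by rewrite msuppX inE => /eqP ->; rewrite weightU.
Qed.

Lemma graded_leq_affine (w : 'I_d -> nat) r p M i :
  (p 0 i != 0 -> r = 0%N) -> (forall j, M j i != 0 -> (r <= w j)%N) ->
  graded leq w r (tnth (affine p M) i).
Proof.
move=> p0 M0 e; rewrite tnth_mktuple => /msuppD_le; rewrite mem_cat => /orP [].
  by rewrite msuppC; case: eqP => // /eqP /p0 ->.
move=> /msupp_sum_le /flattenP [s] /mapP [j _ ->].
have [->|Mj] := eqVneq (M j i) 0; first by rewrite scale0r -mpolyC0 msupp0.
by move=> /msuppZ_le; rewrite msuppX inE => /eqP ->; rewrite weightU M0.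
Qed.

Lemma degree_expand p M n g :
  graded geq (fun=> 1%N) n g -> graded geq (fun=> 1%N) n (expand p M g).
Proof. by apply: graded_geq_comp => i; apply: graded_geq_affine. Qed.

Lemma order_expand r g :
  graded leq (fun=> 1%N) r g -> forall M, graded leq (fun=> 1%N) r (expand 0 M g).
Proof.
move=> gr M; apply: graded_leq_comp gr => i; apply: graded_leq_affine => //.
by rewrite mxE eqxx.
Qed.

(** The order of vanishing at [p] survives a change of basis: passing from [M] to [N] is the linear
    substitution by [N *m invmx M], which has no constant terms. *)
Lemma order_expand_basis p M N r g : M \in unitmx ->
  graded leq (fun=> 1%N) r (expand p M g) ->
  graded leq (fun=> 1%N) r (expand p N g).
Proof.
move=> Mu /order_expand => /(_ (N *m invmx M)).
by rewrite expandK mul0mx addr0 mulmxKV.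
Qed.

End Affine.

(** * Joints on a line *)

Section Slice.
Variables (F : fieldType) (d : nat) (j : 'I_d).
Implicit Types (a e : 'X_{1..d}) (g : {mpoly F[d]}).

Definition setexp e k : 'X_{1..d} := [multinom if i == j then k else e i | i < d].

Lemma setexp_id e : setexp e (e j) = e.
Proof. by apply/mnmP => i; rewrite mnmE; case: eqP => // ->. Qed.

Lemma setexp_setexp e k l : setexp (setexp e k) l = setexp e l.
Proof. by apply/mnmP => i; rewrite !mnmE; case: eqP. Qed.

Lemma mdeg_setexp e k : mdeg (setexp e k) = (k + (mdeg e - e j))%N.
Proof.
rewrite !mdegE (bigD1 j) //= mnmE eqxx [in RHS](bigD1 j) //= addKn.
by congr addn; apply: eq_bigr => i /negPf ij; rewrite mnmE ij.
Qed.

(** With [g] viewed as a polynomial in the variables other than ['X_j], this is the coefficient,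
    univariate in ['X_j], of the monomial given by [e] outside [j]; the value [e j] does not affect
    it. *)
Definition slice e g : {poly F} := \poly_(k < msize g) g@_(setexp e k).

Lemma coef_slice e g k : (slice e g)`_k = g@_(setexp e k).
Proof.
rewrite coef_poly; case: ltnP => // gk; apply/esym/memN_msupp_eq0.
by apply: msize_mdeg_ge; rewrite mdeg_setexp (leq_trans gk) ?leq_addr.
Qed.

Lemma slice_is_linear e : linear (slice e).
Proof.
move=> c g h; apply/polyP => k.
by rewrite coefD coefZ !coef_slice mcoeffD mcoeffZ.
Qed.

HB.instance Definition _ e := GRing.isLinear.Build F {mpoly F[d]} {poly F} _
  (slice e) (slice_is_linear e).

Lemma sliceX e a :
  slice e 'X_[a] = (setexp a 0 == setexp e 0)%:R *: 'X^(a j).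
Proof.
apply/polyP => k; rewrite coef_slice coefZ coefXn mcoeffX -natrM mulnb.
congr ((nat_of_bool _)%:R); apply/eqP/andP => [->|[/eqP ae /eqP ->]].
  by rewrite setexp_setexp mnmE !eqxx.
rewrite -[LHS]setexp_id -(setexp_setexp a 0) ae.
by rewrite setexp_setexp.
Qed.

(** A translation along the axis [j] only replaces ['X_j] by ['X_j + s], so it acts on each slice
    separately. By linearity it suffices to expand a monomial with the binomial formula. *)
Lemma slice_shift e g (s : F) :
  slice e (expand (s *: delta_mx 0 j) 1%:M g) = slice e g \Po ('X + s%:P).
Proof.
rewrite /expand comp_mpolyEX [g in RHS]mpolyE raddf_sum /= raddf_sum /=.
rewrite linear_sum /=.
apply: eq_bigr => a _; rewrite !linearZ /=; congr (_ *: _).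
rewrite sliceX comp_mpolyX comp_polyZ comp_Xn_poly.
have aff i : tnth (affine (s *: delta_mx 0 j) (1%:M : 'M[F]_d)) i =
    (if i == j then s%:MP else 0) + 'X_i.
  rewrite tnth_mktuple !mxE eqxx /= (bigD1 i) //= big1 => [|l li].
    by rewrite mxE eqxx scale1r addr0; case: eqP; rewrite ?mulr1 // mulr0.
  by rewrite mxE (negPf li) scale0r.
rewrite (bigD1 j) //= aff eqxx.
under eq_bigr => i ij do rewrite aff (negPf ij) add0r.
rewrite ['X + _]addrC !exprDn mulr_suml raddf_sum scaler_sumr /=.
apply: eq_bigr => k _.
have -> : (s%:MP ^+ (a j - k) * 'X_j ^+ k *+ 'C(a j, k)) *
    (\prod_(i < d | i != j) 'X_i ^+ a i) =
    (s ^+ (a j - k) *+ 'C(a j, k)) *: 'X_[setexp a k] :> {mpoly F[d]}.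
  rewrite mulrnAl -mulrA -scalerMnl -mul_mpolyC rmorphXn /=; congr (_ * _ *+ _).
  rewrite [in RHS]mpolyXE_id [RHS](bigD1 j) //= mnmE eqxx; congr (_ * _).
  by apply: eq_bigr => i /negPf ij; rewrite mnmE ij.
rewrite linearZ /= sliceX setexp_setexp mnmE eqxx scalerA mulrC -scalerA.
congr (_ *: _); rewrite -scalerMnl -mul_polyC -polyC_exp; congr (_ *+ _).
Qed.

End Slice.

(** Powers of distinct linear factors are coprime, so their product divides [h] and its degree is at
    most that of [h]. *)
Lemma sum_root_order (F : fieldType) (I : eqType) (Q : seq I) (s : I -> F)
    (k : I -> nat) (h : {poly F}) :
  uniq Q -> {in Q &, injective s} -> h != 0 ->
  (forall q, q \in Q -> ('X - (s q)%:P) ^+ k q %| h) ->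
  (\sum_(q <- Q) k q < size h)%N.
Proof.
move=> Qu si h0 kh.
suff /dvdp_leq : \prod_(q <- Q) ('X - (s q)%:P) ^+ k q %| h.
  move=> /(_ h0); rewrite size_prod_seq => [|q _]; last first.
    by rewrite expf_neq0 ?polyXsubC_eq0.
  under eq_bigr do rewrite size_exp_XsubC -addn1.
  by rewrite big_split /= sum1_size -addSn addnK.
elim: Q Qu si kh => [|q Q IH] /=; first by rewrite big_nil dvd1p.
case/andP=> qQ Qu si kh; rewrite big_cons Gauss_dvdp.
  rewrite kh ?mem_head //= IH // => [x y xQ yQ|x xQ].
    by apply: si; rewrite inE ?xQ ?yQ orbT.
  by apply: kh; rewrite inE xQ orbT.
rewrite coprimep_expl // big_seq.
elim/big_ind: _ => [|f g cf cg|x xQ]; first exact: coprimep1.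
  by rewrite coprimepMr cf.
rewrite coprimep_expr // coprimep_XsubC2 // subr_eq0.
apply: contraNneq qQ => sqx.
by rewrite (si q x) ?mem_head // inE xQ orbT.
Qed.

Section LineBound.
Variables (F : fieldType) (d : nat).
Implicit Types (p q : 'rV[F]_d) (g : {mpoly F[d]}).

Lemma sum_exponents_on_line g n (Q : seq 'rV[F]_d) (M : 'rV[F]_d -> 'M[F]_d)
    (j : 'rV[F]_d -> 'I_d) (e : 'rV[F]_d -> 'X_{1..d}) :
  graded geq (fun=> 1%N) n g -> uniq Q ->
  (forall q, q \in Q -> [/\ M q \in unitmx,
     e q \in msupp (expand q (M q) g) &
     graded leq (fun=> 1%N) (mdeg (e q)) (expand q (M q) g)]) ->
  (forall p q, p \in Q -> q \in Q -> exists s, q = p + s *: row (j p) (M p)) ->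
  (\sum_(q <- Q) e q (j q) <= n)%N.
Proof.
move=> gn Qu HQ HL.
have [->|Q0] := eqVneq Q [::]; first by rewrite big_nil.
(* [t q] is the degree of [e q] outside the line; the reference joint [p] minimizes it. *)
pose t q := (mdeg (e q) - e q (j q))%N.
have [p pQ tp] : exists2 p, p \in Q & forall q, q \in Q -> (t p <= t q)%N.
  have [x xQ] : exists x, x \in Q.
    by case: (Q) Q0 => // x Q' _; exists x; rewrite mem_head.
  pose P m := has (fun q => t q == m) Q.
  have exP : exists m, P m by exists (t x); apply/hasP; exists x.
  case: (ex_minnP exP) => m /hasP [p pQ /eqP tpm] mmin.
  by exists p => // q qQ; rewrite tpm; apply: mmin; apply/hasP; exists q.
have [Mu ep _] := HQ p pQ.
pose s q := ((q - p) *m invmx (M p)) 0 (j p).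
have sP q : q \in Q -> q = p + (s q *: delta_mx 0 (j p)) *m M p.
  move=> qQ; have [c qc] := HL p q pQ qQ.
  have qpc : (q - p) *m invmx (M p) = c *: delta_mx 0 (j p).
    by rewrite qc addrC addKr rowE -scalemxAl mulmxK.
  by rewrite /s qpc !mxE !eqxx mulr1 -scalemxAl -rowE -qc.
pose G := expand p (M p) g.
pose h := slice (j p) (e p) G.
(* The coefficient of [h] in degree [e p (j p)] is that of [e p] in [G], which is nonzero. *)
have h0 : h != 0.
  apply: contraTneq ep => h0; rewrite mcoeff_msupp negbK.
  by rewrite -[X in _@_X](setexp_id (j p)) -coef_slice -/G -/h h0 coef0.
have hn : (size h <= n.+1)%N.
  apply/leq_sizeP => k nk; rewrite coef_slice; apply: memN_msupp_eq0.
  apply/negP => /(degree_expand gn); rewrite weight1 mdeg_setexp /= => kn.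
  by move: (leq_trans nk (leq_trans (leq_addr _ _) kn)); rewrite ltnn.
rewrite -ltnS; apply: leq_trans hn.
apply: sum_root_order (s) _ _ Qu _ h0 _ => [x y xQ yQ sxy|q qQ].
  by rewrite (sP x) // (sP y) // sxy.
have [Mqu eq oq] := HQ q qQ.
(* With the basis of [p] used at [q] too, the two expansions differ only by a translation along the
   axis [j p]. *)
have := order_expand_basis (N := M p) Mqu oq.
have -> : expand q (M p) g = expand (s q *: delta_mx 0 (j p)) 1%:M G.
  by rewrite /G expandK mul1mx -sP.
move=> oqp.
pose h' := slice (j p) (e p) (expand (s q *: delta_mx 0 (j p)) 1%:M G).
have kh' : 'X^(e q (j q)) %| h'.
  rewrite -[h'](poly_take_drop (e q (j q))) dvdp_addl ?dvdp_mull //.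
  suff -> : take_poly (e q (j q)) h' = 0 by rewrite dvdp0.
  (* For [k < e q (j q)] the monomial has degree [k + t p < e q (j q) + t q = mdeg (e q)], below the
     order of vanishing at [q]; this is where the minimality of [t p] enters. *)
  apply/polyP => k; rewrite coef_take_poly coef0 coef_slice.
  case: ltnP => // kq; apply: memN_msupp_eq0; apply/negP.
  move=> /oqp; rewrite weight1 mdeg_setexp; have := tp q qQ; rewrite /t.
  have : (e q (j q) <= mdeg (e q))%N by rewrite mdegE (bigD1 (j q)) //= leq_addr.
  lia.
(* Undoing the translation moves the root from [0] to [s q]. *)
move: kh'; rewrite /h' slice_shift -/h => /(dvdp_comp_poly ('X - (s q)%:P)).
rewrite -comp_polyA comp_Xn_poly comp_polyD comp_polyX comp_polyC.
by rewrite subrK comp_polyXr.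
Qed.
End LineBound.

(** * Polynomials vanishing along flats *)

Section Existence.

(** Exponents of degree at most [n] correspond to the [m]-tuples over ['I_n.+1] with sum at most
    [n]. *)
Lemma card_bmultinom m n : #|{: 'X_{1..m < n.+1}}| = 'C(m + n, m).
Proof.
rewrite -card_partial_ord_partitions.
pose f (e : 'X_{1..m < n.+1}) : m.-tuple 'I_n.+1 := [tuple inord (e i) | i < m].
have fE e i : tnth (f e) i = e i :> nat.
  rewrite tnth_mktuple inordK //; apply: leq_ltn_trans (bmdeg e).
  by rewrite mdegE (bigD1 i) //= leq_addr.
have fi : injective f.
  move=> e e' /(congr1 (fun t => tnth t)) ee; apply/val_inj/mnmP => i.
  by rewrite -!fE ee.
rewrite -(card_imset _ fi); apply: eq_card => t; rewrite inE.
apply/imsetP/idP => [[e _ ->]|tn].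
  rewrite big_tuple; under eq_bigr do rewrite fE.
  by rewrite -mdegE -ltnS bmdeg.
have td : (mdeg [multinom val (tnth t i) | i < m] < n.+1)%N.
  by rewrite mdegE ltnS; under eq_bigr do rewrite mnmE; rewrite big_tuple in tn.
exists (BMultinom td) => //; apply: eq_from_tnth => i; apply: val_inj.
by rewrite /= fE mnmE.
Qed.

(* Coordinates at a joint are ordered with the [k] directions of the flat first
   and the [m] directions of the lines last; the least weight of a monomial is
   then the order of vanishing along the flat. *)
Definition line_weight k m (i : 'I_(k + m)) : nat := (k <= i)%N.

Lemma weight_line_weight k m (e : 'X_{1..k + m}) :
  weight (@line_weight k m) e = (\sum_(i < m) e (rshift k i))%N.
Proof.
rewrite /weight big_split_ord /= big1 ?add0n => [|i _]; last first.
  by rewrite /line_weight leqNgt /= ltn_ord.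
by apply: eq_bigr => i _; rewrite /line_weight /= leq_addr mul1n.
Qed.

(** Linear algebra: the unknowns are the coefficients of [g] in degree at most [n]. For each flat
    there is one equation per monomial of degree at most [r] in the line coordinates and at most [n]
    in the flat coordinates. *)
Lemma exists_polynomial_vanishing_on_flats (F : fieldType) (I : finType) k m r n
    (p : I -> 'rV[F]_(k + m)) (M : I -> 'M[F]_(k + m)) :
  (#|I| * ('C(m + r, m) * 'C(k + n, k)) < 'C(k + m + n, k + m))%N ->
  exists g : {mpoly F[k + m]}, [/\ g != 0, graded geq (fun=> 1%N) n g &
    forall i, graded leq (@line_weight k m) r.+1 (expand (p i) (M i) g)].
Proof.
rewrite -!card_bmultinom -!card_prod.
pose S : finType := 'X_{1..(k + m) < n.+1}.
pose T : finType := (I * ('X_{1..m < r.+1} * 'X_{1..k < n.+1}))%type.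
rewrite -[(#|_| < _)%N]/(#|T| < #|S|)%N => TS.
pose glue (a : 'X_{1..m}) (b : 'X_{1..k}) : 'X_{1..k + m} :=
  [multinom match split i with inl x => b x | inr x => a x end | i < k + m].
pose mon (s : 'I_#|S|) : 'X_{1..(k + m) < n.+1} := enum_val s.
pose A : 'M[F]_(#|S|, #|T|) := \matrix_(s, c)
  let c' : T := enum_val c in
  (expand (p c'.1) (M c'.1) 'X_[mon s])@_(glue c'.2.1 c'.2.2).
(* There are more unknowns (rows) than equations (columns). *)
have : kermx A != 0.
  rewrite kermx_eq0 -row_leq_rank -ltnNge.
  exact: leq_ltn_trans (rank_leq_col _) TS.
case/rowV0Pn => u /sub_kermxP uA u0.
pose g : {mpoly F[k + m]} := \sum_s u 0 s *: 'X_[mon s].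
have gE s : g@_(mon s) = u 0 s.
  rewrite /g raddf_sum /= (bigD1 s) //= mcoeffZ mcoeffX eqxx mulr1.
  rewrite big1 ?addr0 // => s' s's; rewrite mcoeffZ mcoeffX.
  by rewrite -bmeqP (inj_eq enum_val_inj) (negPf s's) mulr0.
have gn : graded geq (fun=> 1%N) n g.
  move=> e /msupp_sum_le /flattenP [x] /mapP [s _ ->] /msuppZ_le.
  by rewrite msuppX inE weight1 => /eqP ->; rewrite /= -ltnS bmdeg.
exists g; split=> // [|i e eg].
  apply: contraNneq u0 => g0; apply/eqP/rowP => s.
  by rewrite -gE g0 mcoeff0 mxE.
rewrite ltnNge; apply: contraL eg => er.
(* Monomials of degree above [n] are absent from every expansion, so the finitely many equations
   suffice. *)
have en : (mdeg e < n.+1)%N \/ (n < mdeg e)%N by lia.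
case: en => en; last first.
  apply/negP => /(degree_expand gn); rewrite weight1 /=; lia.
pose a := [multinom e (rshift k j) | j < m].
pose b := [multinom e (lshift m j) | j < k].
have ad : (mdeg a < r.+1)%N.
  rewrite ltnS; apply: leq_trans er; rewrite weight_line_weight mdegE.
  by apply: leq_sum => j _; rewrite mnmE.
have bd : (mdeg b < n.+1)%N.
  apply: leq_ltn_trans en; rewrite !mdegE big_split_ord /=.
  apply: leq_trans (leq_addr _ _).
  by apply: leq_sum => j _; rewrite mnmE.
have eE : glue a b = e.
  apply/mnmP => j; rewrite mnmE.
  by case: (splitP j) => x jx; rewrite mnmE; congr (e _); apply: val_inj.
pose c := (i, (BMultinom ad, BMultinom bd)).
move/rowP/(_ (enum_rank c)): uA; rewrite !mxE => uA.
rewrite mcoeff_msupp negbK -[X in _ == X]uA; apply/eqP.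
rewrite /g /expand (raddf_sum (comp_mpoly _)) (raddf_sum (mcoeff _)) /=.
apply: eq_bigr => s _.
by rewrite comp_mpolyZ mcoeffZ mxE enum_rankK /= eE.
Qed.
End Existence.

(** * Double counting of exponents over joints and lines *)

Section JointBound.
Variables (F : fieldType) (k m n r : nat) (i0 : 'I_m) (T : eqType).
Variables (g : {mpoly F[k + m]}) (J : seq 'rV[F]_(k + m)) (Ls : seq T).
Variable M : 'rV[F]_(k + m) -> 'M[F]_(k + m).
Variable (line : 'rV[F]_(k + m) -> 'I_m -> T).

Lemma joints_order_leq_lines_degree :
  g != 0 -> graded geq (fun=> 1%N) n g -> uniq J -> uniq Ls ->
  (forall q, q \in J -> [/\ M q \in unitmx, injective (line q),
     forall i, line q i \in Ls &
     graded leq (@line_weight k m) r (expand q (M q) g)]) ->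
  (forall p q i i', p \in J -> q \in J -> line p i = line q i' ->
     exists s, q = p + s *: row (rshift k i) (M p)) ->
  (size J * r <= size Ls * n)%N.
Proof.
(* The monomial order compares degrees first, so its least monomial [mlast] has least degree. *)
move=> g0 gn Ju Lu HJ HL; pose e q := mlast (expand q (M q) g).
have eP q : q \in J -> [/\ M q \in unitmx, e q \in msupp (expand q (M q) g) &
     graded leq (fun=> 1%N) (mdeg (e q)) (expand q (M q) g)].
  case/HJ => Mu _ _ _; split=> //; first by rewrite mlast_supp // expand_neq0.
  by move=> a /mlast_lemc /lemc_mdeg; rewrite weight1.
have er q : q \in J -> (r <= \sum_(i < m) e q (rshift k i))%N.
  move=> qJ; case: (HJ q qJ) => _ _ _; case: (eP q qJ) => _ eq _ /(_ _ eq).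
  by rewrite weight_line_weight.
apply: leq_trans
  (_ : \sum_(q <- J) \sum_(i < m) e q (rshift k i) <= _)%N.
  rewrite -sum1_size big_distrl /= big_seq [leqRHS]big_seq.
  by apply: leq_sum => q /er; rewrite mul1n.
have -> : (\sum_(q <- J) \sum_(i < m) e q (rshift k i) =
   \sum_(l <- Ls) \sum_(q <- J) \sum_(i < m | line q i == l) e q (rshift k i))%N.
  rewrite [RHS]exchange_big /= big_seq [RHS]big_seq; apply: eq_bigr => q qJ.
  under [RHS]eq_bigr do rewrite big_mkcond.
  rewrite [RHS]exchange_big /=; apply: eq_bigr => i _.
  have [_ _ /(_ i) lL _] := HJ q qJ.
  rewrite (bigD1_seq (line q i)) //= eqxx big1 ?addn0 // => l.
  by rewrite eq_sym => /negPf ->.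
rewrite -sum1_size big_distrl /=; apply: leq_sum => l _; rewrite mul1n.
(* [hit q] finds the index under which [l] is a chosen line of [q], unique by injectivity. The
   default [i0] is never reached on [Q]. *)
pose hit q := [pick i | line q i == l].
pose j q := rshift k (odflt i0 (hit q)).
pose Q := [seq q <- J | hit q].
have lineQ q : q \in Q -> q \in J /\ line q (odflt i0 (hit q)) = l.
  by rewrite mem_filter /hit; case: pickP => //= i /eqP.
rewrite (bigID hit) /= addnC big1 ?add0n => [|q]; last first.
  by rewrite /hit; case: pickP => // no _; rewrite big_pred0.
have -> : (\sum_(q <- J | hit q) \sum_(i < m | line q i == l) e q (rshift k i) =
           \sum_(q <- Q) e q (j q))%N.
  rewrite -big_filter big_seq [RHS]big_seq; apply: eq_bigr => q /lineQ [qJ ql].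
  have [_ li _ _] := HJ q qJ.
  rewrite (bigD1 (odflt i0 (hit q))) ?ql //= big1 ?addn0 // => i.
  by rewrite -ql => /andP [/eqP/li ->]; rewrite eqxx.
apply: (sum_exponents_on_line (M := M) gn); first exact: filter_uniq.
  by move=> q /lineQ [/eP].
move=> p q /lineQ [pJ pl] /lineQ [qJ ql].
by apply: (HL _ _ _ (odflt i0 (hit q)) pJ qJ); rewrite pl ql.
Qed.
End JointBound.

(** * The choice of degrees *)

Section Counting.
Local Open Scope nat_scope.

(** In the binomial expansion every term after the first has a power of [t] at most [t ^ m.-1]. *)
Lemma expnD_leq L t c m : 0 < m -> 0 < t ->
  (L * t + c) ^ m <= L ^ m * t ^ m + t ^ m.-1 * (L + c) ^ m.
Proof.
move=> m0 t0; rewrite !expnDn big_ord_recl /= bin0 mul1n subn0 muln1 expnMn.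
rewrite leq_add2l [in leqRHS]big_ord_recl mulnDr big_distrr /=.
apply: leq_trans (leq_addl _ _); apply: leq_sum => i _.
rewrite [leqRHS]mulnCA leq_mul2l; apply/orP; right.
rewrite mulnA leq_mul2r; apply/orP; right.
rewrite expnMn mulnC leq_mul2r; apply/orP; right.
by rewrite leq_pexp2l // /bump /=; lia.
Qed.

Lemma exists_scale A L N c m : 0 < m -> A * L ^ m < N ^ m ->
  exists2 t, 0 < t & A * (L * t + c) ^ m < (N * t) ^ m.
Proof.
(* The integers [A * L ^ m] and [N ^ m] differ by at least one, which leaves a gap of [t ^ m]; this
   choice of [t] makes it exceed the lower-order terms [A * (L + c) ^ m * t ^ m.-1]. *)
move=> m0 AN; pose t := (A * (L + c) ^ m).+1; exists t => //.
apply: leq_ltn_trans (_ : A * L ^ m * t ^ m + t.-1 * t ^ m.-1 < _).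
  apply: leq_trans (leq_mul (leqnn A) (expnD_leq L c m0 (ltn0Sn _))) _.
  by rewrite mulnDr !mulnA leq_add2l mulnAC.
apply: leq_trans (_ : (A * L ^ m).+1 * t ^ m <= _); last first.
  by rewrite expnMn leq_mul2r AN orbT.
rewrite mulSn addnC ltn_add2r -{2}(prednK m0) expnS ltn_mul2r /t /=.
by rewrite expn_gt0 /= ltnS.
Qed.

Lemma leq_exp_ffact k n m : n.+1 ^ m <= (m + k + n) ^_ m.
Proof.
elim: m => // m IH; rewrite !addSn ffactSS expnS leq_mul //; lia.
Qed.

Lemma ffact_leq_exp n m : n ^_ m <= n ^ m.
Proof.
by elim: m => // m IH; rewrite ffactnSr expnSr leq_mul // leq_subr.
Qed.

Lemma ffactnDm n k m : n ^_ (m + k) = n ^_ m * (n - m) ^_ k.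
Proof.
elim: m n => [|m IH] n; first by rewrite mul1n subn0.
case: n => [|n]; first by rewrite !ffact0n mul0n.
by rewrite addSn !ffactSS subSS IH mulnA.
Qed.

(** After multiplication by [(k + m)!], the common factor [(k + n) ^_ k] splits off from both sides;
    what remains compares [(m + r) ^_ m <= (m + r) ^ m] with [n.+1 ^ m <= (m + k + n) ^_ m]. *)
Lemma bin_scale A k m r n :
  A * 'C(k + m, m) * (m + r) ^ m < n.+1 ^ m ->
  A * ('C(m + r, m) * 'C(k + n, k)) < 'C(k + m + n, k + m).
Proof.
move=> H; rewrite -(ltn_pmul2r (fact_gt0 (k + m))) bin_ffact.
rewrite -(bin_fact (leq_addl k m)) addnK.
have -> : A * ('C(m + r, m) * 'C(k + n, k)) * ('C(k + m, m) * (m`! * k`!)) =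
  A * 'C(k + m, m) * (m + r) ^_ m * (k + n) ^_ k.
  rewrite -!bin_ffact; lia.
rewrite [k + m in X in _ < X ^_ _]addnC [k + m in X in _ < _ ^_ X]addnC ffactnDm.
have -> : m + k + n - m = k + n by lia.
apply: leq_ltn_trans (_ : A * 'C(k + m, m) * (m + r) ^ m * (k + n) ^_ k < _).
  by rewrite leq_mul2r leq_mul2l ffact_leq_exp !orbT.
apply: leq_trans (_ : n.+1 ^ m * (k + n) ^_ k <= _).
  by rewrite ltn_pmul2r // ffact_gt0 leq_addr.
by rewrite leq_mul2r leq_exp_ffact orbT.
Qed.

End Counting.

(** * Coordinates at a joint *)

Section Frames.
Variables (F : fieldType).

(** A basis of the direction space is completed to a basis of the whole space, and the flat is where
    the last [m] coordinates vanish. Origin and basis form a pair so that one use of [choice]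
    selects both. *)
Lemma flat_frame k m (A : set 'rV[F]_(k + m)) : is_flat k A ->
  exists pM : 'rV[F]_(k + m) * 'M[F]_(k + m), pM.2 \in unitmx /\
    A = [set x | rsubmx ((x - pM.1) *m invmx pM.2) = 0].
Proof.
case=> p [V [Vk ->]].
pose B : 'M[F]_(k, k + m) := \matrix_(i < k) (vbasis V)`_i.
have VB x : x \in V <-> (x <= B)%MS.
  split=> [xV|/submxP [D ->]].
    rewrite (coord_vbasis xV); apply: summx_sub => i _; apply: scalemx_sub.
    by rewrite -(rowK (fun i : 'I_k => (vbasis V)`_i) (cast_ord Vk i)) row_sub.
  rewrite mulmx_sum_row; apply: rpred_sum => i _; apply: rpredZ.
  by rewrite rowK vbasis_mem // mem_nth // size_tuple Vk.
have rB : \rank B = k.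
  apply/eqP/inj_row_free => v vB.
  have /freeP fV := basis_free (vbasisP V).
  apply/rowP => i; rewrite mxE; rewrite mulmx_sum_row in vB.
  have := fV (fun j => v 0 (cast_ord Vk j)).
  rewrite (reindex (cast_ord (esym Vk))) /=; last first.
    by exists (cast_ord Vk) => j _; rewrite ?cast_ordK ?cast_ordKV.
  move=> /(_ _ (cast_ord (esym Vk) i)); rewrite cast_ordKV; apply.
  rewrite -[RHS]vB; apply: eq_bigr => j _.
  by rewrite cast_ordKV rowK.
exists (p, row_ebase B); split; first exact: row_ebase_unit.
suff H (y : 'rV[F]_(k + m)) : y *m copid_mx k = 0 <-> rsubmx y = 0.
  have VE x : x \in V <-> rsubmx (x *m invmx (row_ebase B)) = 0.
    by rewrite VB submxE /cokermx rB mulmxA -H; split=> /eqP.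
  by apply/seteqP; split=> x /VE.
rewrite /copid_mx pid_mx_block -{1}(hsubmxK y) mulmxBr mulmx1 mul_row_block.
rewrite !mulmx0 mulmx1 !addr0 -[X in X - _]/(row_mx _ _) opp_row_mx add_row_mx.
rewrite subrr subr0; split=> [/(congr1 rsubmx)|->]; last exact: row_mx0.
by rewrite row_mxKr => ->; rewrite linear0.
Qed.

Lemma line_direction d (A : set 'rV[F]_d) x : is_line A -> A x ->
  exists v, A = [set y | exists s, y = x + s *: v].
Proof.
case=> p [V [V1 ->]] /= xp.
have V0 : V != 0%VS by rewrite -dimv_eq0 V1.
have VE : V = <[vpick V]>%VS.
  apply/esym/eqP; rewrite eqEdim -memvE memv_pick dim_vline vpick0 V0.
  by rewrite V1.
exists (vpick V); apply/seteqP; split=> y /=.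
  move=> yp; have /vlineP [s sE] : y - x \in <[vpick V]>%VS.
    rewrite -VE; have -> : y - x = (y - p) - (x - p) by rewrite opprB addrA subrK.
    exact: rpredB.
  by exists s; rewrite -sE addrC subrK.
by case=> s ->; rewrite addrAC rpredD // rpredZ // memv_pick.
Qed.

(** A nonzero linear form kills all rows of a singular [M]; its kernel translated to [x] is the
    hyperplane. *)
Lemma not_unit_hyperplane d (M : 'M[F]_d) (x : 'rV[F]_d) : M \notin unitmx ->
  exists2 H, is_hyperplane H & forall y a, y = x + a *m M -> H y.
Proof.
move=> Mu.
have : kermx M^T != 0 by rewrite kermx_eq0 row_free_unit unitmx_tr.
case/rowV0Pn => v /sub_kermxP vM v0.
pose f : 'Hom('rV[F]_d, 'rV[F]_1) := linfun (mulmxr v^T).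
have fE y : f y = y *m v^T by rewrite lfunE.
exists [set y | y - x \in lker f]; last first.
  move=> y a -> /=; rewrite addrC addKr memv_ker fE -mulmxA.
  by rewrite -[M]trmxK -trmx_mul vM trmx0 mulmx0.
exists x, (lker f); split=> //.
have := limg_ker_dim f fullv; rewrite capfv dimvf /dim /= mul1n => dE.
suff f1 : \dim (limg f) = 1%N.
  by move/(congr1 (fun n => (n - 1)%N)): dE; rewrite f1 addnK.
apply/eqP; rewrite eqn_leq; apply/andP; split.
  by apply: leq_trans (dimvS (subvf _)) _; rewrite dimvf.
rewrite lt0n dimv_eq0; apply: contraNneq v0 => f0.
apply/eqP/rowP => i; rewrite mxE.
have : f (delta_mx 0 i) \in limg f by rewrite memv_img ?memvf.
rewrite f0 memv0 fE -rowE => /eqP/rowP/(_ 0).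
by rewrite !mxE.
Qed.

(** The first [k] rows of [M], which span the flat, are kept and the last [m] are replaced by the
    directions of the lines. If the result were singular, the lines and the flat would share a
    hyperplane. *)
Lemma joint_frame k m (x p : 'rV[F]_(k + m)) (M : 'M[F]_(k + m))
    (f : set 'rV[F]_(k + m)) (l : 'I_m -> set 'rV[F]_(k + m)) :
  M \in unitmx -> f = [set x | rsubmx ((x - p) *m invmx M) = 0] ->
  (forall i, is_line (l i)) -> (\bigcap_i l i) `&` f = [set x] ->
  ~ (exists H, [/\ is_hyperplane H, forall i, l i `<=` H & f `<=` H]) ->
  exists N : 'M[F]_(k + m), [/\ N \in unitmx, usubmx N = usubmx M &
    forall i, l i = [set y | exists s, y = x + s *: row (rshift k i) N]].
Proof.
move=> Mu fE lL lf nH.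
have [lx fx] : ((\bigcap_i l i) `&` f) x by rewrite lf.
have /choice [v vE] i := line_direction (lL i) (lx i I).
pose N := col_mx (usubmx M) (\matrix_i v i).
have lE i : l i = [set y | exists s, y = x + s *: row (rshift k i) N].
  by rewrite vE /N rowKd rowK.
exists N; split=> //; last by rewrite /N col_mxKu.
apply: contrapT => /negP /(not_unit_hyperplane x) [H Hh HN]; apply: nH.
exists H; split=> // [i y|y]; first rewrite lE /=.
  by case=> s ->; apply: (HN _ (s *: delta_mx 0 (rshift k i)));
    rewrite -scalemxAl -rowE.
move=> fy; pose a := lsubmx ((y - x) *m invmx M).
apply: (HN _ (row_mx a 0)).
rewrite /N mul_row_col mul0mx addr0.
have : rsubmx ((y - x) *m invmx M) = 0.
  rewrite fE /= in fy fx.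
  have -> : y - x = (y - p) - (x - p) by rewrite opprB addrA subrK.
  rewrite mulmxBl linearB /=.
  by rewrite fy fx subr0.
move=> r0; have -> : a *m usubmx M = (y - x) *m invmx M *m M.
  have -> : (y - x) *m invmx M = row_mx a 0 by rewrite -r0 hsubmxK.
  by rewrite -[in RHS](vsubmxK M) mul_row_col mul0mx addr0.
by rewrite mulmxKV // addrC subrK.
Qed.

(** Since [x] lies on the flat and both bases agree on its directions, the change of coordinates
    sends each of the last [m] coordinates to a linear form in these same coordinates, so no weight
    is lost. *)
Lemma vanishing_at_joint k m r (g : {mpoly F[k + m]}) (x p : 'rV[F]_(k + m))
    (M N : 'M[F]_(k + m)) :
  M \in unitmx -> usubmx N = usubmx M -> rsubmx ((x - p) *m invmx M) = 0 ->
  graded leq (@line_weight k m) r (expand p M g) ->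
  graded leq (@line_weight k m) r (expand x N g).
Proof.
move=> Mu NM xp gr.
have -> : expand x N g =
    expand ((x - p) *m invmx M) (N *m invmx M) (expand p M g).
  by rewrite expandK !mulmxKV // addrC subrK.
apply: graded_leq_comp gr => i; rewrite /line_weight.
case: (leqP k i) => ki; last by move=> e _.
have [i' ->] : exists i', i = rshift k i'.
  have im : (i - k < m)%N by have := ltn_ord i; lia.
  by exists (Ordinal im); apply: val_inj; rewrite /= subnKC.
apply: graded_leq_affine => [|j].
  by move/rowP/(_ i'): xp; rewrite !mxE => ->; rewrite eqxx.
case: (leqP k j) => // jk; suff -> : (N *m invmx M) j (rshift k i') = 0.
  by rewrite eqxx.
have -> : j = lshift m (Ordinal jk) by apply: val_inj.
have : usubmx (N *m invmx M) = usubmx (1%:M : 'M[F]_(k + m)).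
  by rewrite -(mulmxV Mu) -!mul_usub_mx NM.
move/matrixP/(_ (Ordinal jk) (rshift k i')); rewrite !mxE => ->.
by rewrite eq_lrshift.
Qed.

End Frames.

(** * Bounding the number of joints *)

(** Taking finite subsets [J] of [Js] gives a uniform bound, from which the finiteness of [Js]
    itself will follow. *)
Lemma joints_count (F : fieldType) k m (J : {fset 'rV[F]_(k + m)})
    (Js : set 'rV[F]_(k + m)) (Ls Fs : {fset set 'rV[F]_(k + m)}) :
  (0 < m)%N -> joints_configuration m Js Ls Fs -> [set` J] `<=` Js ->
  (#|` J| ^ m <= #|` Fs| * 'C(k + m, m) * #|` Ls| ^ m)%N.
Proof.
move=> m0 [Lline Fflat Jjoint] JJs; rewrite leqNgt; apply/negP.
case/(exists_scale m m0) => t t0.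
have [->|/fset0Pn [x0 x0J]] := eqVneq J fset0.
  by rewrite cardfs0 mul0n exp0n.
have L0 : (0 < #|` Ls|)%N.
  have [l [f [[_ lL] _ _ _]]] := Jjoint x0 (JJs _ x0J).
  by rewrite cardfs_gt0; apply/fset0Pn; exists (l (Ordinal m0)).
have N0 : (0 < #|` J|)%N by rewrite cardfs_gt0; apply/fset0Pn; exists x0.
(* Order [r.+1 = L * t] along the flats and degree [n = N * t - 1] would give
   [N * (L * t) <= L * (N * t - 1)], which is absurd. *)
set L := #|` Ls|; set N := #|` J|; pose r := (L * t).-1; pose n := (N * t).-1.
have rE : r.+1 = (L * t)%N by rewrite prednK // muln_gt0 L0.
have nE : n.+1 = (N * t)%N by rewrite prednK // muln_gt0 N0.
move=> H.
have /bin_scale : (#|` Fs| * 'C(k + m, m) * (m + r) ^ m < n.+1 ^ m)%N.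
  rewrite nE; apply: leq_ltn_trans H; rewrite leq_mul2l leq_exp2r // -rE.
  by apply/orP; right; lia.
have fr (f : Fs) : exists pM : 'rV[F]_(k + m) * 'M[F]_(k + m), pM.2 \in unitmx /\
    val f = [set x | rsubmx ((x - pM.1) *m invmx pM.2) = 0].
  by apply: flat_frame; have := Fflat _ (valP f); rewrite addnK.
have [pM pME] := choice fr.
rewrite cardfE => /(exists_polynomial_vanishing_on_flats
  (fun f => (pM f).1) (fun f => (pM f).2)) []  g [g0 gn gF].
have jf x : exists Ml : 'M[F]_(k + m) * ('I_m -> set 'rV[F]_(k + m)), x \in J ->
    [/\ Ml.1 \in unitmx, injective Ml.2, forall i, Ml.2 i \in Ls,
      graded leq (@line_weight k m) r.+1 (expand x Ml.1 g) &
      forall i, Ml.2 i = [set y | exists s, y = x + s *: row (rshift k i) Ml.1]].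
  (* Points outside [J] get a dummy value so that [choice] applies to all points. *)
  have [xJ|] := boolP (x \in J); last by exists (1%:M, fun=> set0).
  have [l [f [[li lL] fF lf nH]]] := Jjoint x (JJs _ xJ).
  have [pu /= pE] := pME (FSetSub fF).
  have [M [Mu MM ME]] := joint_frame pu pE (fun i => Lline _ (lL i)) lf nH.
  exists (M, l) => _; split=> //; apply: vanishing_at_joint pu MM _ (gF _).
  have [_] : ((\bigcap_i l i) `&` f) x by rewrite lf.
  by have /= -> := congr1 (fun A : set _ => A x) pE.
have [Ml MlE] := choice jf.
have := @joints_order_leq_lines_degree F k m n r.+1 (Ordinal m0) _ g J Ls
  (fun x => (Ml x).1) (fun x => (Ml x).2) g0 gn (fset_uniq J) (fset_uniq Ls).
have HJ q : q \in J -> [/\ (Ml q).1 \in unitmx, injective (Ml q).2,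
    forall i, (Ml q).2 i \in Ls &
    graded leq (@line_weight k m) r.+1 (expand q (Ml q).1 g)].
  by case/MlE.
move/(_ HJ) => H'.
have : (size J * r.+1 <= size Ls * n)%N.
  apply: H' => p q i i' pJ qJ pq.
  have [_ _ _ _ pE] := MlE p pJ; have [_ _ _ _ qE] := MlE q qJ.
  (* The joint [q] lies on the common line, which is also parametrized from [p]. *)
  have : (Ml q).2 i' q by rewrite qE /=; exists 0; rewrite scale0r addr0.
  by rewrite -pq pE.
rewrite rE -/N -/L => H2.
have : (L * n < L * (N * t))%N by rewrite ltn_pmul2l // -nE.
have -> : (L * (N * t) = N * (L * t))%N by lia.
by rewrite ltnNge H2.
Qed.

Theorem theorem4p2 (R : realType) (F : fieldType) (d m : nat)
    (hm : (1 <= m <= d - 1)%N)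
    (Js : set 'rV[F]_d) (Ls Fs : {fset set 'rV[F]_d})
    (hconf : joints_configuration m Js Ls Fs) :
  finite_set Js /\
  (#|` fset_set Js|%:R : R) <=
    ('C(d, m)%:R `^ (m%:R^-1)) * #|` Ls|%:R * (#|` Fs|%:R `^ (m%:R^-1)).
Proof.
have /andP [m0 md] := hm; have [k dE] : exists k, d = (k + m)%N.
  by exists (d - m)%N; lia.
subst d; have bound J := @joints_count F k m J Js Ls Fs m0 hconf.
(* An infinite [Js] would contain a finite set larger than the uniform bound, as
   [#|J| <= #|J| ^ m]. *)
have Jfin : finite_set Js.
  apply: contrapT => /infinite_set_fset.
  move=> /(_ (#|` Fs| * 'C(k + m, m) * #|` Ls| ^ m).+1) [J JJs].
  apply/negP; rewrite -ltnNge ltnS; apply: leq_trans (bound J JJs).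
  by case: (#|` J|) => // c; rewrite -{1}(expn1 c.+1) leq_pexp2l.
split=> //.
have := bound (fset_set Js); rewrite fset_setK // => /(_ (@subset_refl _ _)).
set N := #|` _|; set L := #|` Ls|; set K := #|` Fs| => NL.
have m0R : (0 : R) <= m%:R^-1 by rewrite invr_ge0 ler0n.
(* Writing each cardinal as an [m]-th root puts both sides under one monotone root and leaves the
   bound in natural numbers. *)
have root a : (a%:R : R) = (a ^ m)%:R `^ (m%:R^-1).
  rewrite natrX -powR_mulrn ?ler0n // -powRrM mulfV ?powRr1 ?ler0n //.
  by rewrite pnatr_eq0 -lt0n.
rewrite [N%:R]root [L%:R]root -!powRM ?mulr_ge0 ?ler0n // -!natrM.
rewrite ge0_ler_powR ?nnegrE ?ler0n // ler_nat.
by apply: leq_trans NL _; rewrite [leqRHS]mulnC !mulnA.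
Qed.
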